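(* Fix $\bar\kappa>0$. Suppose that, for $P_X$-almost every $x$, the posterior distribution $Q_x$ of the real parameter $\theta$ given $X=x$ is supported on an interval $I_x\subset\mathbb{R}$ with $\mathrm{diam}(I_x)\le\bar\kappa$. Let the admissible Bayes actions be the scalar actions $a\in\mathbb{R}$, and let $\mathcal{O}$ be Bayes optimality under the posterior distribution of $\theta\mid X=x$. Then for every $\kappa,\kappa'\ge\bar\kappa$, $\mathcal{O}(L_\kappa)=\mathcal{O}(L_{\kappa'})$, where $L_\kappa$ is the canonical Huber loss with threshold $\kappa$. Consequently, the losses $\{L_\kappa:\kappa\ge\bar\kappa\}$ belong to a single exclusivity class within this family (equivalently, to a single identification component).
   Context: $P_X$ is the marginal law of the observation $X$. For $\kappa>0$ the canonical Huber loss is $L_\kappa(\theta,a)=\frac12(a-\theta)^2$ if $|a-\theta|\le\kappa$ and $L_\kappa(\theta,a)=\kappa|a-\theta|-\frac12\kappa^2$ otherwise. Bayes optimality: a measurable decision rule $\delta:\mathcal{X}\to\mathbb{R}$ belongs to $\mathcal{O}(L)$ iff for $P_X$-a.e. $x$ the action $\delta(x)$ minimizes $a\mapsto\int L(\theta,a)\,dQ_x(\theta)$ over $a\in\mathbb{R}$. For an ambient family $\mathcal{M}$ of losses: $\mathcal{C}\subseteq\mathcal{M}$ is an exclusivity region within $\mathcal{M}$ if no decision rule $\delta$ belongs to $\mathcal{O}(L)$ for some $L\in\mathcal{C}$ and also to $\mathcal{O}(L')$ for some $L'\in\mathcal{M}\setminus\mathcal{C}$. An exclusivity class within $\mathcal{M}$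 for $\delta$ is a maximal exclusivity region $\mathcal{C}$ within $\mathcal{M}$ with $\mathcal{C}\subseteq\{L:\delta\in\mathcal{O}(L)\}$. The identification graph joins $L$ and $L'$ whenever $\mathcal{O}(L)\cap\mathcal{O}(L')\neq\emptyset$; identification components are its connected components. *)

(* Defs.v *)
From HB Require Import structures.
From Stdlib Require Export Relation_Operators.
From mathcomp Require Export all_boot all_order all_algebra.
From mathcomp Require Export all_classical all_reals all_analysis.
Import Order.TTheory GRing.Theory Num.Theory.
Import numFieldNormedType.Exports.

Set Implicit Arguments.
Unset Strict Implicit.
Unset Printing Implicit Defensive.

Local Open Scope classical_set_scope.
Local Open Scope ring_scope.

(** The exclusivity notions depend on the optimality correspondence only; here
    [O L : set D] is the set of decision rules that are optimal for [L]. *)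
Section Exclusivity.
Context {L D : Type}.
Variables (O : L -> set D) (M : set L).

Definition exclusivity_region (C : set L) : Prop :=
  C `<=` M /\
  ~ exists delta : D,
      (exists2 l, C l & O l delta) /\ (exists2 l', (M `\` C) l' & O l' delta).

(* The maximality, with respect to inclusion, is among the exclusivity regions
   contained in [[set l | O l delta]]. *)
Definition exclusivity_class (delta : D) (C : set L) : Prop :=
  let admissible B := exclusivity_region B /\ B `<=` [set l | O l delta] in
  admissible C /\ forall B, admissible B -> C `<=` B -> B = C.

Definition identification_edge (l l' : L) : Prop :=
  [/\ M l, M l' & O l `&` O l' !=set0].

(* The identification graph has vertex set [M], its edge relation is symmetric,
   and [clos_refl_trans] is the existence of a finite path. *)
Definition identification_component (K : set L) : Prop :=
  exists2 l, M l & K = [set l' | M l' /\ clos_refl_trans L identification_edge l l'].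

End Exclusivity.

Section Diameter.
Context {R : realType}.

Definition diam (A : set R) : \bar R :=
  ereal_sup [set (`|s - t|)%:E | s in A & t in A].

End Diameter.

(** Losses are written [l theta a], with the parameter first. *)
Section BayesOptimality.
Context {R : realType} {dX : measure_display} {X : measurableType dX}.

Definition huber (k theta a : R) : R :=
  if `|a - theta| <= k then 2^-1 * (a - theta) ^+ 2
  else k * `|a - theta| - 2^-1 * k ^+ 2.

Definition huber_family (kbar : R) : set (R -> R -> R) :=
  [set huber k | k in [set k | kbar <= k]].

(* [Q] is a regular conditional distribution of [theta] given [obs]. *)
Definition is_posterior {dT : measure_display} {T : measurableType dT}
    (P : probability T R) (theta : {mfun T >-> R}) (obs : {mfun T >-> X})
    (Q : R.-pker X ~> R) : Prop :=
  forall (A : set X) (B : set R), measurable A -> measurable B ->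
    P (obs @^-1` A `&` theta @^-1` B) =
    (\int[distribution P obs]_(x in A) Q x B)%E.

(* Posterior risks are extended reals, so that no integrability is presupposed;
   they are well defined in [[0, +oo]] for measurable nonnegative losses. *)
Definition bayes_optimal (PX : probability X R) (Q : R.-pker X ~> R)
    (l : R -> R -> R) : set {mfun X >-> R} :=
  [set delta | {ae PX, forall x, forall a : R,
     (\int[Q x]_theta (l theta (delta x))%:E <=
      \int[Q x]_theta (l theta a)%:E)%E}].

End BayesOptimality.

(* Main.v *)
Require Import Defs.
From mathcomp Require Import ring lra measurable_realfun.
Import Order.TTheory GRing.Theory Num.Theory.
Import numFieldNormedType.Exports.

Local Open Scope classical_set_scope.
Local Open Scope ring_scope.

(** Let [mu] be a posterior carried by [[lo, hi]] with [hi - lo <= k], and [m] its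
    mean. For an action in [[lo, hi]] the loss is quadratic on the support, so
    the risk is [1/2 Var + 1/2 (a - m)^2]. For an action [a] outside, let [p] be
    the nearer endpoint: as [huber k] is superadditive in [|a - theta|], the
    risk at [a] exceeds the risk at [p] by at least [huber k 0 (a - p) > 0].
    Hence [m] is the unique minimizer whatever [k] is; it is measurable in the
    observation, so the posterior mean is a rule that is optimal for the whole
    family at once. *)

Section Huber.
Context {R : realType}.
Implicit Types k theta a lo hi p : R.

Lemma huber_ge0 k theta a : 0 <= k -> 0 <= huber k theta a.
Proof.
move=> k0; rewrite /huber; case: ifPn => [_|]; first by rewrite mulr_ge0 ?sqr_ge0.
by rewrite -ltNge; nra.
Qed.

Lemma huber_gt0 k a : 0 < k -> a != 0 -> 0 < huber k 0 a.
Proof.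
rewrite -normr_gt0 => k0 a0; rewrite /huber subr0 -real_normK ?num_real//.
by case: ifPn => [_|]; [nra | rewrite -ltNge; nra].
Qed.

Lemma huber_le_sqr k theta a : huber k theta a <= 2^-1 * (a - theta) ^+ 2.
Proof.
rewrite /huber; case: ifP => // _; rewrite -[(a - _) ^+ 2]real_normK ?num_real//.
by have := sqr_ge0 (`|a - theta| - k); nra.
Qed.

Lemma huber_sqr k lo hi theta a : hi - lo <= k ->
  lo <= theta <= hi -> lo <= a <= hi -> huber k theta a = 2^-1 * (a - theta) ^+ 2.
Proof.
move=> hk /andP[? ?] /andP[? ?]; rewrite /huber ifT//.
by rewrite ler_norml; apply/andP; split; lra.
Qed.

Lemma huberN k theta a : huber k (- theta) (- a) = huber k theta a.
Proof. by rewrite /huber -opprD normrN sqrrN. Qed.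

Lemma huber_above k theta p a : 0 < k -> theta <= p -> p - theta <= k -> p <= a ->
  2^-1 * (p - theta) ^+ 2 + huber k 0 (a - p) <= huber k theta a.
Proof.
move=> k0 tp pk pa; rewrite /huber subr0 !ger0_norm; [|lra..].
case: ifPn; case: ifPn; rewrite -?ltNge => ? ?.
- by nra.
- have -> : k = (p - theta) + (a - p) - (a - theta - k) by ring.
  by have := sqr_ge0 (a - theta - k); nra.
- by lra.
- by nra.
Qed.

Lemma huber_below k theta p a : 0 < k -> p <= theta -> theta - p <= k -> a <= p ->
  2^-1 * (p - theta) ^+ 2 + huber k 0 (a - p) <= huber k theta a.
Proof.
move=> k0 pt pk ap; rewrite -huberN -[huber k theta a]huberN oppr0.
have -> : (p - theta) ^+ 2 = (- p - - theta) ^+ 2 by ring.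
have -> : - (a - p) = - a - - p by ring.
by apply: huber_above; lra.
Qed.

Lemma huber_proj k lo hi a : 0 < k -> lo <= hi -> hi - lo <= k ->
  exists2 p, lo <= p <= hi & forall theta, lo <= theta <= hi ->
    2^-1 * (p - theta) ^+ 2 + huber k 0 (a - p) <= huber k theta a.
Proof.
move=> k0 lohi hk; have [alo|loa] := leP a lo.
  exists lo; first by rewrite lexx.
  by move=> t /andP[? ?]; apply: huber_below => //; lra.
have [hia|ahi] := leP hi a.
  exists hi; first by rewrite lexx andbT.
  by move=> t /andP[? ?]; apply: huber_above => //; lra.
have ain : lo <= a <= hi by rewrite !ltW.
exists a => // t tin; rewrite (huber_sqr k lo hi t)// /huber !subrr normr0 (ltW k0).
by rewrite expr0n mulr0 addr0.
Qed.

Lemma measurable_huber k a : measurable_fun setT (huber k ^~ a : R -> R).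
Proof.
rewrite /huber; apply: measurable_fun_ifT.
- apply: measurable_fun_ler => //; apply: measurableT_comp => //.
  exact: measurable_funB.
- by apply: measurable_funM => //; apply: measurable_funX; apply: measurable_funB.
- apply: measurable_funB => //; apply: measurable_funM => //.
  by apply: measurableT_comp => //; exact: measurable_funB.
Qed.

End Huber.

Lemma measureC_eq0 {R : realType} (d : measure_display) (T : measurableType d)
    (mu : {measure set T -> \bar R}) (A : set T) :
  measurable A -> mu setT = 1%E -> mu A = 1%E -> mu (~` A) = 0%E.
Proof.
move=> mA mu1 muA; have finT : (mu setT < +oo)%E by rewrite mu1 ltry.
rewrite -setTD; apply: etrans (measureD measurableT mA finT) _.
rewrite setTI; transitivity (mu setT - mu A)%E => //.
by rewrite mu1 muA subee.
Qed.

Section PosteriorRisk.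
Context {R : realType} (mu : {measure set R -> \bar R}) (lo hi : R).
Hypotheses (mu1 : mu setT = 1%E) (muI : mu `[lo, hi]%classic = 1%E).

Let mI : measurable `[lo, hi]%classic. Proof. by []. Qed.

Let muIC : mu (~` `[lo, hi]%classic) = 0%E.
Proof. exact: measureC_eq0. Qed.

Let lohi : lo <= hi.
Proof.
rewrite leNgt; apply/negP => hilo; have := muI.
by rewrite set_itv_ge ?bnd_simp -?ltNge// measure0 => /eqP; rewrite eq_sym onee_eq0.
Qed.

Let integrable_itv (f : R -> R) (M : R) : measurable_fun setT f ->
  (forall x, lo <= x <= hi -> `|f x| <= M) -> mu.-integrable `[lo, hi]%classic (EFin \o f).
Proof.
move=> mf fM; apply: measurable_bounded_integrable => //.
- by rewrite muI ltry.
- exact: measurable_funS mf.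
- exists M; split; first exact: num_real.
  move=> N MN x /=; rewrite in_itv/= => xI.
  by rewrite (le_trans _ (ltW MN))// fM.
Qed.

Lemma integral_itv (f : R -> R) : measurable_fun setT f ->
  mu.-integrable `[lo, hi]%classic (EFin \o f) ->
  (\int[mu]_x (f x)%:E = (\int[mu]_(x in `[lo, hi]%classic) f x)%:E)%E.
Proof.
move=> mf intf.
have mC : measurable (~` `[lo, hi]%classic) by exact: measurableC.
have DE : setT `\` ~` `[lo, hi]%classic = `[lo, hi]%classic by rewrite setTD setCK.
have intT : mu.-integrable setT (EFin \o f).
  apply/(negligible_integrable mC measurableT _ muIC); last by rewrite DE.
  exact/measurable_EFinP.
rewrite (negligible_integral mC measurableT intT muIC) DE /Rintegral fineK//.
exact: integrable_fin_num.
Qed.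

Let mean : R := \int[mu]_x x.

Let id_bound x : lo <= x <= hi -> `|x| <= `|lo| + `|hi|.
Proof.
move=> /andP[lx xh]; rewrite ler_norml.
have := ler_norm hi; have := ler_norm (- lo); rewrite normrN.
by have := normr_ge0 lo; have := normr_ge0 hi; move=> *; apply/andP; split; lra.
Qed.

Let intid : mu.-integrable `[lo, hi]%classic (EFin \o @id R).
Proof. by apply: (integrable_itv _ (`|lo| + `|hi|)). Qed.

Let meanE : mean = \int[mu]_(x in `[lo, hi]%classic) x.
Proof. by rewrite /mean {1}/Rintegral integral_itv. Qed.

Let mean_cst c : \int[mu]_(_ in `[lo, hi]%classic) c = c.
Proof. by rewrite Rintegral_cst// muI mulr1. Qed.

Let intcst c : mu.-integrable `[lo, hi]%classic (EFin \o fun=> c).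
Proof. by apply: (integrable_itv _ `|c|). Qed.

Let mean_itv : lo <= mean <= hi.
Proof.
rewrite meanE; apply/andP; split.
  rewrite -[leLHS](mean_cst lo); apply: le_Rintegral => // x.
  by rewrite /= in_itv/= => /andP[].
rewrite -[leRHS](mean_cst hi); apply: le_Rintegral => // x.
by rewrite /= in_itv/= => /andP[].
Qed.

Let intsqr (p : R) :
  mu.-integrable `[lo, hi]%classic (EFin \o (fun x => 2^-1 * (p - x) ^+ 2)).
Proof.
apply: (integrable_itv _ (2^-1 * (`|p| + (`|lo| + `|hi|)) ^+ 2)).
  by apply: measurable_funM => //; apply: measurable_funX; apply: measurable_funB.
move=> x /id_bound xb; rewrite normrM ger0_norm// ler_pM2l// normrX ler_sqr ?nnegrE//.
  by rewrite (le_trans (ler_normB _ _))// lerD2l.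
Qed.

Let inthuber k a : 0 <= k ->
  mu.-integrable `[lo, hi]%classic (EFin \o (huber k ^~ a)).
Proof.
move=> k0; apply: (le_integrable mI _ _ (intsqr a)).
  by apply/measurable_EFinP; apply: measurable_funS (measurable_huber k a).
move=> x _ /=; rewrite lee_fin ger0_norm ?huber_ge0// ger0_norm ?huber_le_sqr//.
by rewrite mulr_ge0 ?sqr_ge0.
Qed.

Let variance : R := \int[mu]_(x in `[lo, hi]%classic) (2^-1 * (mean - x) ^+ 2).

Let bias_variance (p : R) :
  \int[mu]_(x in `[lo, hi]%classic) (2^-1 * (p - x) ^+ 2) =
  variance + 2^-1 * (p - mean) ^+ 2.
Proof.
have intB : mu.-integrable `[lo, hi]%classic
    (EFin \o (fun x => mean - x)).
  exact (integrableB mI (intcst mean) intid).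
have intC : mu.-integrable `[lo, hi]%classic
    (EFin \o (fun x => (p - mean) * (mean - x))).
  exact (integrableZl mI _ intB).
have intD : mu.-integrable `[lo, hi]%classic
    (EFin \o (fun x => 2^-1 * (mean - x) ^+ 2 + (p - mean) * (mean - x))).
  exact (integrableD mI (intsqr mean) intC).
transitivity (\int[mu]_(x in `[lo, hi]%classic)
    (2^-1 * (mean - x) ^+ 2 + (p - mean) * (mean - x) + 2^-1 * (p - mean) ^+ 2)).
  by apply: eq_Rintegral => x _; field.
rewrite RintegralD// RintegralD// RintegralZl// RintegralB// !mean_cst -meanE.
by rewrite subrr mulr0 addr0.
Qed.

Lemma huber_risk_minimizer k d : 0 < k -> hi - lo <= k ->
  (forall a, (\int[mu]_theta (huber k theta d)%:E <=
              \int[mu]_theta (huber k theta a)%:E)%E) <-> d = mean.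
Proof.
move=> k0 hk.
have riskE a : (\int[mu]_theta (huber k theta a)%:E =
    (\int[mu]_(theta in `[lo, hi]%classic) huber k theta a)%:E)%E.
  by apply: integral_itv; [exact: measurable_huber | apply: inthuber; exact: ltW].
have risk_mean : \int[mu]_(theta in `[lo, hi]%classic) huber k theta mean = variance.
  apply: eq_Rintegral => x; rewrite inE/= in_itv/= => xI.
  exact: huber_sqr xI mean_itv.
have risk_gt a : a != mean ->
    variance < \int[mu]_(theta in `[lo, hi]%classic) huber k theta a.
  move=> am; have [p pI pP] := huber_proj k lo hi a k0 lohi hk.
  apply: (@lt_le_trans _ _
      (variance + 2^-1 * (p - mean) ^+ 2 + huber k 0 (a - p))).
    rewrite -addrA ltrDl; have [->|pm] := eqVneq p mean.
      by rewrite subrr expr0n mulr0 add0r huber_gt0// subr_eq0.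
    by rewrite ltr_pwDl ?huber_ge0 ?(ltW k0)// mulr_gt0// exprn_even_gt0//= subr_eq0.
  rewrite -bias_variance -[X in _ + X]mean_cst -RintegralD//.
  apply: le_Rintegral => //.
  - exact (integrableD mI (intsqr p) (intcst _)).
  - by apply: inthuber; exact: ltW.
split=> [/(_ mean)|-> a].
  rewrite !riskE risk_mean lee_fin => dmin; apply/eqP/negPn/negP => /risk_gt.
  by rewrite ltNge dmin.
rewrite !riskE risk_mean lee_fin; have [->|/risk_gt/ltW//] := eqVneq a mean.
by rewrite risk_mean.
Qed.

End PosteriorRisk.

Lemma interval_full_itv {R : realType} (mu : {measure set R -> \bar R}) (I : set R)
    (k : R) : mu setT = 1%E -> is_interval I -> (diam I <= k%:E)%E -> mu I = 1%E ->
  exists lo hi : R, hi - lo <= k /\ mu `[lo, hi]%classic = 1%E.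
Proof.
move=> mu1 itvI dI muI.
have Idist s t : I s -> I t -> s - t <= k.
  move=> Is It; apply: (le_trans (ler_norm _)); rewrite -lee_fin.
  by apply: le_trans dI; apply: ereal_sup_ubound; exists s => //; exists t.
have [t It] : I !=set0.
  apply/set0P/eqP => I0; move: muI; rewrite I0 measure0 => /eqP.
  by rewrite eq_sym onee_eq0.
have ubI : has_ubound I by exists (t + k) => s Is; rewrite -lerBlDl Idist.
have lbI : has_lbound I by exists (t - k) => s Is; rewrite lerBlDl -lerBlDr Idist.
exists (inf I), (sup I); split.
  rewrite lerBlDl -lerBlDr; apply: lb_le_inf; first by exists t.
  move=> s Is; rewrite lerBlDr; apply: ge_sup; first by exists t.
  by move=> r Ir; rewrite -lerBlDl Idist.
apply/eqP; rewrite eq_le; apply/andP; split.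
  by rewrite -mu1 le_measure// ?inE.
rewrite -muI le_measure// ?inE//; first exact: is_interval_measurable.
by move=> s Is; rewrite /= in_itv/=; apply/andP; split; [exact: ge_inf|exact: ub_le_sup].
Qed.

Lemma measurable_posterior_mean {R : realType} (dX : measure_display)
    (X : measurableType dX) (Q : R.-ker X ~> R) :
  measurable_fun setT (fun x => \int[Q x]_theta theta).
Proof.
apply: measurableT_comp => //.
under eq_fun do rewrite integralE.
apply: emeasurable_funB; apply: measurable_fun_integral_kernel => //.
- by move=> U mU; exact: measurable_kernel.
- by apply: measurable_funepos; exact/measurable_EFinP.
- by move=> U mU; exact: measurable_kernel.
- by apply: measurable_funeneg; exact/measurable_EFinP.
Qed.

Theorem proposition3 (R : realType)
    (dT : measure_display) (T : measurableType dT) (P : probability T R)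
    (dX : measure_display) (X : measurableType dX)
    (theta : {mfun T >-> R}) (obs : {mfun T >-> X})
    (Q : R.-pker X ~> R) (hQ : is_posterior P theta obs Q)
    (kbar : R) (kbar_gt0 : 0 < kbar)
    (I : X -> set R)
    (hI : {ae distribution P obs, forall x,
             [/\ is_interval (I x), (diam (I x) <= kbar%:E)%E
               & Q x (I x) = 1%E]}) :
  let O := bayes_optimal (distribution P obs) Q in
  let M := huber_family kbar in
  [/\ forall k k' : R, kbar <= k -> kbar <= k' -> O (huber k) = O (huber k'),
      exists C : set (R -> R -> R),
        (exists delta, exclusivity_class O M delta C) /\
        (forall k : R, kbar <= k -> C (huber k))
    & exists K : set (R -> R -> R),
        identification_component O M K /\
        (forall k : R, kbar <= k -> K (huber k))].
Proof.
move=> O M.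
have OE k : kbar <= k -> O (huber k) =
    [set delta | {ae distribution P obs, forall x, delta x = \int[Q x]_t t}].
  move=> hk.
  have opt x d : [/\ is_interval (I x), (diam (I x) <= kbar%:E)%E & Q x (I x) = 1%E] ->
      (forall a, (\int[Q x]_t (huber k t d)%:E <= \int[Q x]_t (huber k t a)%:E)%E) <->
      d = \int[Q x]_t t.
    move=> [itvI dI QI].
    have [lo [hi [lohi Qlohi]]] := interval_full_itv _ _ _ (prob_kernel x) itvI dI QI.
    apply: (huber_risk_minimizer _ _ _ (prob_kernel x) Qlohi).
      exact: lt_le_trans hk.
    exact: le_trans hk.
  apply/seteqP; split => delta; apply: filterS2 hI => x /opt ox; by move=> /ox.
pose delta : {mfun X >-> R} := mfun_Sub (mem_set (measurable_posterior_mean _ _ Q)).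
have Odelta k : kbar <= k -> O (huber k) delta.
  by move=> hk; rewrite OE//; apply: aeW.
have Mhuber k : kbar <= k -> M (huber k) by move=> hk; exists k.
split.
- by move=> k k' hk hk'; rewrite !OE.
- exists M; split => //; exists delta; split; last by move=> B [[BM _] _] MB; exact/seteqP.
  split; last by move=> _ [k hk <-]; exact: Odelta.
  by split => // -[d [_ [l' [Ml' nMl'] _]]].
- exists [set l | M l /\ clos_refl_trans _ (identification_edge O M) (huber kbar) l].
  split; first by exists (huber kbar) => //; exact: Mhuber.
  move=> k hk; split; first exact: Mhuber.
  by apply: rt_step; split; [exact: Mhuber|exact: Mhuber|exists delta; split; exact: Odelta].
Qed.
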